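(* Let $\mathbb{G}$ be a homogeneous self-affine carpet with contraction ratios $r_1\le r_2$ and attractor $\Lambda$, satisfying the rectangular open set condition and such that $\mathrm{p}_2\mathbb{G}$ satisfies the weak separation condition. Then $$\dim_{\mathrm B}(\Lambda)=\lim_{n\to\infty}\frac{\log(\#\mathbb{G}_n)}{-n\log r_1}+\dim_{\mathrm B}(\mathrm{p}_2\Lambda)\Big(1-\frac{\log r_2}{\log r_1}\Big),$$ where $\dim_{\mathrm B}(\mathrm{p}_2\Lambda)$ is the box-counting dimension of the attractor $\mathrm{p}_2\Lambda$ of the IFS $\mathrm{p}_2\mathbb{G}$.
   Context: A self-affine carpet is a finite set $\mathbb{G}$ of maps $S(x,y)=(r_{S,1}x+t_{S,1},\,r_{S,2}y+t_{S,2})$ of $\mathbb{R}^2$ with $|r_{S,\ell}|\in(0,1)$. Its attractor $\Lambda$ is the unique non-empty compact set with $\Lambda=\bigcup_{S\in\mathbb{G}}S(\Lambda)$. Write $\mathrm{p}_1(x,y)=x$, $\mathrm{p}_2(x,y)=y$; for a map $S$ of the form $S(x,y)=(r_{S,1}x+t_{S,1},\,r_{S,2}y+t_{S,2})$ with $|r_{S,\ell}|\in(0,1)$, $\mathrm{p}_\ell S$ is the map $u\mapsto r_{S,\ell}u+t_{S,\ell}$ of $\mathbb{R}$, and $\mathrm{p}_\ell\mathbb{G}=\{\mathrm{p}_\ell S:S\in\mathbb{G}\}$ as a set, a self-similar IFS on $\mathbb{R}$ with attractor $\mathrm{p}_\ell\Lambda$. Standing assumption: $\mathrm{conv}(\mathrm{p}_1\Lambda)\times\mathrm{conv}(\mathrm{p}_2\Lambda)=[0,1]^2$.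 $\mathbb{G}_n=\{S_1\circ\dots\circ S_n:S_i\in\mathbb{G}\}$ as a set of maps. Homogeneous: there are positive reals $r_1,r_2$ with $r_{S,1}=r_1$ and $r_{S,2}=r_2$ for all $S\in\mathbb{G}$; by convention one always takes $r_1\le r_2$ in this case. Rectangular open set condition: $S((0,1)^2)\cap\hat S((0,1)^2)=\emptyset$ for all $S\ne\hat S\in\mathbb{G}$. A self-similar IFS $\mathbb{F}$ satisfies the weak separation condition if the identity map is an isolated point of $\{S^{-1}\circ\hat S:S,\hat S\in\mathbb{F}^*\}$, where $\mathbb{F}^*$ is the set of all finite compositions (of length $\geq 1$) of maps of $\mathbb{F}$. *)

(* Defs.v *)
From mathcomp Require Import all_boot all_order all_algebra.
From mathcomp Require Import finmap.
From mathcomp Require Import all_classical all_reals all_analysis.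

Set Implicit Arguments.
Unset Strict Implicit.
Unset Printing Implicit Defensive.

Import Order.TTheory GRing.Theory Num.Theory.
Import numFieldNormedType.Exports.

Local Open Scope classical_set_scope.
Local Open Scope ring_scope.

(* [compositions F 0] is [[set id]]; only the lengths n >= 1 matter. *)
Fixpoint compositions (T : Type) (F : set (T -> T)) (n : nat) : set (T -> T) :=
  if n is m.+1 then [set f \o g | f in F & g in compositions F m] else [set id].

Definition finite_compositions (T : Type) (F : set (T -> T)) : set (T -> T) :=
  \bigcup_(n in [set n | (0 < n)%N]) compositions F n.

Definition is_attractor (T : topologicalType) (F : set (T -> T)) (K : set T)
    : Prop :=
  [/\ K !=set0, compact K & K = \bigcup_(f in F) (f @` K)].

Definition diag_affine (R : realType) (r t : R * R) (p : R * R) : R * R :=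
  (r.1 * p.1 + t.1, r.2 * p.2 + t.2).

Definition self_affine_carpet (R : realType) (G : set (R * R -> R * R)) : Prop :=
  finite_set G /\
  forall S, G S -> exists r t : R * R,
    [/\ 0 < `|r.1| < 1, 0 < `|r.2| < 1 & S = diag_affine r t].

(* The second coordinate of a carpet map at (u, y) depends on y only, so the
   first argument can be frozen at 0; see [proj2_diag_affine]. *)
Definition proj2_map (R : realType) (S : R * R -> R * R) : R -> R :=
  fun u => (S (0, u)).2.

Lemma proj2_diag_affine (R : realType) (r t : R * R) :
  proj2_map (diag_affine r t) = fun u => r.2 * u + t.2.
Proof. by []. Qed.

Definition proj2_ifs (R : realType) (G : set (R * R -> R * R)) : set (R -> R) :=
  @proj2_map R @` G.

Definition homogeneous (R : realType) (G : set (R * R -> R * R)) (r1 r2 : R)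
    : Prop :=
  [/\ 0 < r1, 0 < r2 &
      forall S, G S -> exists t : R * R, S = diag_affine (r1, r2) t].

Definition convex_hull (R : realType) (A : set R) : set R :=
  smallest (@convex_set R R^o) A.

Definition rectangular_osc (R : realType) (G : set (R * R -> R * R)) : Prop :=
  forall S S', G S -> G S' -> S <> S' ->
    (S @` (`]0, 1[ `*` `]0, 1[)) `&` (S' @` (`]0, 1[ `*` `]0, 1[)) = set0.

Definition inverse_compositions (R : realType) (F : set (R -> R))
    : set (R -> R) :=
  [set h | exists f finv g,
     [/\ finite_compositions F f, finite_compositions F g,
         cancel f finv, cancel finv f & h = finv \o g]].

(* On affine maps of the line, pointwise convergence, locally uniform
   convergence and convergence of the coefficients are the same topology. *)
Definition weak_separation (R : realType) (F : set (R -> R)) : Prop :=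
  isolated (inverse_compositions F : set {ptws R -> R}) id.

(* In the plane [ball x (d / 2)] is the open axis-parallel square of side d
   centred at x.  The infimum is a minimum when E is totally bounded; it is the
   junk value 0 when E has no finite cover. *)
Definition covering_number (R : realType) (T : pseudoMetricType R) (E : set T)
    (d : R) : R :=
  inf [set (size s)%:R | s in [set s : seq T |
         E `<=` \bigcup_(x in [set` s]) ball x (d / 2)]].

Definition box_ratio (R : realType) (T : pseudoMetricType R) (E : set T)
    (d : R) : R :=
  ln (covering_number E d) / - ln d.

Definition box_dim_exists (R : realType) (T : pseudoMetricType R) (E : set T)
    : Prop := cvg (box_ratio E d @[d --> 0^'+]).

Definition box_dim (R : realType) (T : pseudoMetricType R) (E : set T) : R :=
  lim (box_ratio E d @[d --> 0^'+]).

Definition growth_ratio (R : realType) (G : set (R * R -> R * R)) (r : R)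
    (n : nat) : R :=
  ln (#|` fset_set (compositions G n)|%:R) / (- n%:R * ln r).

(* Main.v *)
(** Write [N = #G], [K = p_2 L] and [N(E, d)] for the covering number.  By the
    rectangular open set condition the [N ^ n] words of length [n] give
    distinct maps, whose images of the open unit square are disjoint rectangles
    of size [r1 ^ n * r2 ^ n], with [r1 <= r2].  A square of side [r1 ^ n]
    meets at most nine of them, and the part of [L] inside one of them is as
    hard to cover as its projection, a copy of [K] scaled by [r2 ^ n].  Hence
    [N(L, r1 ^ n)] and [N ^ n * N(K, (r1 / r2) ^ n)] agree up to a constant
    factor.  The box dimension of [K] exists because
    [N(K, 6 r2 ^ m) * N(K, r2 ^ n) <= N(K, r2 ^ (m + n))]. *)
Require Import Defs.
From mathcomp Require Import all_boot all_order all_algebra.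
From mathcomp Require Import finmap.
From mathcomp Require Import all_classical all_reals all_analysis.
From mathcomp Require Import ring lra.

Set Implicit Arguments.
Unset Strict Implicit.
Unset Printing Implicit Defensive.

Import Order.TTheory GRing.Theory Num.Theory.
Import numFieldNormedType.Exports.
Local Open Scope classical_set_scope.
Local Open Scope ring_scope.

(** * Covering numbers and counting arguments *)

Definition ball_cover (R : realType) (T : pseudoMetricType R) (E : set T)
    (d : R) (s : seq T) : Prop :=
  E `<=` \bigcup_(x in [set` s]) ball x (d / 2).

Lemma covering_number_le (R : realType) (T : pseudoMetricType R) (E : set T)
    (d : R) (s : seq T) :
  ball_cover E d s -> covering_number E d <= (size s)%:R.
Proof.
move=> cs; apply: ge_inf; last by exists s.
by exists 0 => _ [t _ <-]; exact: ler0n.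
Qed.

(** Sizes of covers are natural numbers, so once a finite cover exists the infimum is a genuine
    minimum. *)
Lemma covering_number_attained (R : realType) (T : pseudoMetricType R)
    (E : set T) (d : R) (s : seq T) :
  ball_cover E d s ->
  exists2 s0, ball_cover E d s0 & covering_number E d = (size s0)%:R.
Proof.
move=> cs.
pose P n := `[< exists2 t : seq T, ball_cover E d t & size t = n >].
have exP : exists n, P n by exists (size s); apply/asboolP; exists s.
case: (ex_minnP exP) => n /asboolP[t ct <-] minn.
exists t => //; apply/eqP; rewrite eq_le covering_number_le //=.
apply: lb_le_inf; first by exists (size s)%:R, s.
move=> _ [u cu <-]; rewrite ler_nat minn //.
by apply/asboolP; exists u.
Qed.

Lemma le_covering_number (R : realType) (T : pseudoMetricType R)
    (E : set T) (d c : R) (s : seq T) :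
  ball_cover E d s ->
  (forall s', ball_cover E d s' -> c <= (size s')%:R) ->
  c <= covering_number E d.
Proof. by move=> /covering_number_attained[t ct ->]; apply. Qed.

Lemma covering_number_ge1 (R : realType) (T : pseudoMetricType R)
    (E : set T) (d : R) (s : seq T) :
  E !=set0 -> ball_cover E d s -> 1 <= covering_number E d.
Proof.
move=> [x Ex] cs; apply: (le_covering_number cs) => -[|y t] // ct.
  by have [] := ct _ Ex.
by rewrite (ler_nat _ 1).
Qed.

(** [h] moves centres and may go between different spaces: it is used as the identity, as an affine
    rescaling, and as a projection followed by a rescaling. *)
Lemma covering_number_sub (R : realType) (T U : pseudoMetricType R)
    (E : set T) (F : set U) (d e : R) (s : seq U) (h : U -> T) :
  ball_cover F e s ->
  (forall t, ball_cover F e t -> ball_cover E d [seq h x | x <- t]) ->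
  covering_number E d <= covering_number F e.
Proof.
move=> cs FE; apply: (le_covering_number cs) => t ct.
by rewrite -(size_map h) covering_number_le //; exact: FE.
Qed.

Lemma covering_number_scale (R : realType) (T : pseudoMetricType R)
    (E : set T) (d e : R) (s : seq T) :
  d <= e -> ball_cover E d s -> covering_number E e <= covering_number E d.
Proof.
move=> de cs; apply: (covering_number_sub (h := id) cs) => t ct.
rewrite map_id => x /ct[y ty xy]; exists y => //.
by apply: le_ball xy; rewrite ler_pM2r ?invr_gt0.
Qed.

Lemma covering_number_bigU (R : realType) (T : pseudoMetricType R)
    (I : eqType) (s : seq I) (E : I -> set T) (U : set T) (d c : R) :
  U `<=` \bigcup_(i in [set` s]) E i ->
  (forall i, i \in s -> exists2 t, ball_cover (E i) d t & (size t)%:R <= c) ->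
  (exists t, ball_cover U d t) /\ covering_number U d <= (size s)%:R * c.
Proof.
move=> UE Ec.
suff [t ct st] : exists2 t, ball_cover U d t & (size t)%:R <= (size s)%:R * c.
  by split; [exists t | apply: le_trans st; exact: covering_number_le].
elim: s U UE Ec => [|i s IH] U UE Ec.
  by exists [::]; rewrite ?mul0r // => x /UE[].
have [||t ct st] := IH (\bigcup_(j in [set` s]) E j).
- by [].
- by move=> j js; apply: Ec; rewrite in_cons js orbT.
have [t' ct' st'] := Ec i (mem_head _ _).
exists (t' ++ t).
  move=> x /UE[j /=]; rewrite in_cons => /predU1P[->|js] xj.
    by have [y /= yt ?] := ct' _ xj; exists y => //=; rewrite mem_cat yt.
  have [y /= yt ?] := ct x (ex_intro2 _ _ j js xj).
  by exists y => //=; rewrite mem_cat yt orbT.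
by rewrite size_cat natrD -natr1 mulrDl mul1r addrC lerD.
Qed.

(** The sets [O i] are pairwise disjoint, so each point of [P] serves at most one index; a choice of
    test points thus bounds a multiplicity. *)
Lemma count_le_size (I : eqType) (Z : eqType) (s : seq I) (P : seq Z)
    (a : pred I) (O : I -> set Z) :
  uniq s ->
  (forall i j x, i \in s -> j \in s -> O i x -> O j x -> i = j) ->
  (forall i, i \in s -> a i -> exists2 x, x \in P & O i x) ->
  (count a s <= size P)%N.
Proof.
move=> us Oinj; elim: P a => [|x P IH] a aO.
  rewrite leqn0 -[_ == _]negbK -lt0n -has_count; apply/hasPn => i is_.
  by apply/negP => /(aO i is_)[].
pose b i := `[< O i x >].
have -> : count a s = (count (predI b a) s + count (predI (predC b) a) s)%N.
  by rewrite -2!count_filter count_predC size_filter.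
rewrite /= -add1n leq_add ?IH //; last first.
  move=> i is_ /andP[nO ai]; have [y + Oiy] := aO i is_ ai.
  by rewrite in_cons => /predU1P[yx|yP]; [case/asboolPn: nO; rewrite -yx|exists y].
rewrite -size_filter; set u := seq.filter _ _.
have : uniq u by rewrite filter_uniq.
have : forall i, i \in u -> i \in s /\ O i x.
  by move=> i; rewrite mem_filter => /andP[/andP[/asboolP ? _] ?].
case: u => [|i [|j u]] //= h /andP[]; rewrite in_cons negb_or => /andP[/eqP ij].
have [is_ Oi] := h i (mem_head _ _).
have [js Oj] : j \in s /\ O j x by apply: h; rewrite !inE eqxx orbT.
by case: ij; exact: Oinj Oi Oj.
Qed.

(** Double count the incidences between the balls of an optimal cover of [U] and the sets [E i]: the
    balls that meet [E i] cover it, and each ball is counted at most [k] times. *)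
Lemma sum_covering_number_le (R : realType) (T : pseudoMetricType R)
    (I : eqType) (s : seq I) (E : I -> set T) (U : set T) (d : R) (k : nat)
    (t0 : seq T) :
  ball_cover U d t0 -> (forall i, i \in s -> E i `<=` U) ->
  (forall x, (count (fun i => `[< ball x (d / 2) `&` E i !=set0 >]) s <= k)%N) ->
  \sum_(i <- s) covering_number (E i) d <= k%:R * covering_number U d.
Proof.
move=> /covering_number_attained[t ct ->] EU sk.
pose a i x := `[< ball x (d / 2) `&` E i !=set0 >].
apply: (@le_trans _ _ (\sum_(i <- s) (count (a i) t)%:R)).
  rewrite big_seq [leRHS]big_seq; apply: ler_sum => i is_.
  rewrite -size_filter; apply: covering_number_le => x Ex.
  have [y /= yt xy] := ct _ (EU _ is_ _ Ex); exists y => //=.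
  by rewrite mem_filter yt andbT; apply/asboolP; exists x.
rewrite -natr_sum -natrM ler_nat.
under eq_bigr do rewrite -sum1_count big_mkcond.
rewrite exchange_big /=.
under eq_bigr do rewrite -big_mkcond sum1_count.
apply: (@leq_trans (\sum_(x <- t) k)); first by apply: leq_sum => x _; exact: sk.
by rewrite big_const_seq count_predT iter_addn_0.
Qed.

(** Greedy choice, by induction on a cover by balls of radius [e / 2]: a ball containing a point [y]
    of [E] lies inside [ball y e], so once [ball y e] is removed the remaining balls cover the
    rest. *)
Lemma separated_net (R : realType) (T : pseudoMetricType R) (E : set T)
    (e : R) (s : seq T) :
  0 < e -> ball_cover E e s ->
  exists t : seq T, [/\ uniq t, forall x, x \in t -> E x,
    forall x y, x \in t -> y \in t -> ball x e y -> x = y &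
    ball_cover E (2 * e) t].
Proof.
move=> e0.
have e2 : 2 * e / 2 = e by rewrite mulrC mulKf.
rewrite /ball_cover e2.
elim: s E => [|c s IH] E cs.
  by exists [::]; split => // x /cs[].
have [[y [Ey cy]]|nE] := pselect (exists y, E y /\ ball c (e / 2) y); last first.
  apply: IH => x Ex; have [z /= + xz] := cs _ Ex.
  by rewrite in_cons => /predU1P[zc|zs]; [case: nE; exists x; rewrite -zc|exists z].
have [|t [ut tE tsep tc]] := IH (E `&` ~` ball y e).
  move=> x [Ex yx]; have [z /= + xz] := cs _ Ex.
  rewrite in_cons => /predU1P[zc|zs]; last by exists z.
  by case: yx; apply: (@ball_split _ _ c) => //; [exact: ball_sym|rewrite -zc].
have yy : ball y e y by exact: ballxx.
exists (y :: t); split => /=.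
- by rewrite ut andbT; apply/negP => /tE[_]; apply.
- by move=> x; rewrite in_cons => /predU1P[->//|/tE[]].
- move=> x z; rewrite !in_cons => /predU1P[->|xt] /predU1P[->|zt] //.
  + by move=> yz; have [_ []] := tE _ zt.
  + by move=> xy; have [_ []] := tE _ xt; exact: ball_sym.
  + exact: tsep.
- move=> x Ex; have [yx|yx] := pselect (ball y e x).
    by exists y => //=; exact: mem_head.
  by have [//|z /= zt ?] := tc x; exists z => //=; rewrite in_cons zt orbT.
Qed.

(** * Superadditive sequences and limits along geometric scales *)

Lemma cvg_invn (R : realType) : n%:R^-1 @[n --> \oo] --> (0 : R).
Proof. by rewrite -(cvg_shiftS (fun n => n%:R^-1 : R)); exact: cvg_harmonic. Qed.

(* Fekete's lemma with a defect [s] in the index; the limit is the supremum of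
   [u n / (n + s)]. *)
Lemma cvg_superadditive (R : realType) (u : nat -> R) (s : nat) (B : R) :
  (0 < s)%N -> (forall n, 0 <= u n) ->
  (forall m n, u m + u n <= u (m + n + s)%N) ->
  (forall n, u n <= B * n.+1%:R) ->
  exists l : R, u n / n%:R @[n --> \oo] --> l.
Proof.
move=> s0 u0 uD uB.
have pos n : (0 : R) < (n + s)%:R by rewrite ltr0n addn_gt0 s0 orbT.
have B0 : 0 <= B by have := uB 0%N; rewrite mulr1; exact: le_trans.
pose E := [set u n / (n + s)%:R | n in [set: nat]].
have ubE : ubound E B.
  move=> _ [n _ <-]; rewrite ler_pdivrMr //.
  by apply: le_trans (uB n) _; rewrite ler_wpM2l // ler_nat -addn1 leq_add2l.
have supE : has_sup E by split; [exists (u 0%N / (0 + s)%:R), 0%N | exists B].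
have ule n : u n <= sup E * (n + s)%:R.
  by rewrite -ler_pdivrMr //; apply: (ub_le_sup _) => /=; [exists B | exists n].
have sup0 : 0 <= sup E.
  by rewrite -(pmulr_lge0 _ (pos 0%N)); exact: le_trans (ule 0%N).
exists (sup E); apply/cvgrPdist_le => e e0.
have e20 : 0 < e / 2 by rewrite divr_gt0.
have [_ [m _ <-]] := sup_adherent e20 supE.
set a := u m / _ => ea.
have a0 : 0 <= a by rewrite divr_ge0 // ltW.
(* Each copy of [u m] uses up [m + s] indices; the leftover term [u j] is dropped as nonnegative. *)
have qm q j : u m *+ q <= u (q * (m + s) + j)%N.
  elim: q => [|q IH]; first by rewrite mulr0n.
  rewrite mulrS mulSn; apply: le_trans (lerD (lexx _) IH) _.
  by apply: le_trans (uD _ _) _; rewrite addnAC -!addnA lexx.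
have low n : a * (n%:R - (m + s)%:R) <= u n.
  have p0 : (0 < m + s)%N by rewrite addn_gt0 s0 orbT.
  rewrite [in leRHS](divn_eq n (m + s)); apply: le_trans (qm _ _).
  rewrite -[u m](@divfK _ (m + s)%:R) ?gt_eqF // -/a -mulrnAr ler_wpM2l //.
  rewrite lerBlDr -mulrnA mulnC -natrD ler_nat.
  by rewrite [leqLHS](divn_eq n (m + s)) leq_add2l ltnW // ltn_mod.
near=> n.
have n0 : (0 : R) < n%:R by rewrite ltr0n; near: n; exact: nbhs_infty_gt.
have h1 : sup E * s%:R <= e * n%:R.
  rewrite -ler_pdivrMl // ltW //; near: n; exact: nbhs_infty_gtr.
have h2 : a * (m + s)%:R <= e / 2 * n%:R.
  rewrite -ler_pdivrMl // ltW //; near: n; exact: nbhs_infty_gtr.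
rewrite distrC ler_distl ler_pdivlMr // ler_pdivrMr //; apply/andP; split.
  apply: le_trans (low n); rewrite mulrBr; nra.
by apply: le_trans (ule n) _; rewrite natrD mulrDl mulrDr; lra.
Unshelve. all: by end_near. Qed.

(** Between consecutive powers of [rho] monotonicity bounds [phi d], while [- ln d] varies by at
    most [- ln rho], which is negligible as [d] tends to 0. *)
Lemma cvg_geometric_scale (R : realType) (phi : R -> R) (rho l : R) :
  0 < rho < 1 -> (forall d, 0 < d -> 0 <= phi d) ->
  (forall d e, 0 < d -> d <= e -> phi e <= phi d) ->
  phi (rho ^+ n) / n%:R @[n --> \oo] --> l ->
  phi d / - ln d @[d --> 0^'+] --> l / - ln rho.
Proof.
move=> /andP[rho0 rho1] phi0 phi_le cphi.
have la0 : 0 < - ln rho by rewrite oppr_gt0 ln_lt0 // rho0.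
set la := - ln rho in la0 *.
have lnX n : - ln (rho ^+ n) = n%:R * la by rewrite lnXn // mulr_natl mulNrn.
have rhoX n : 0 < rho ^+ n by rewrite exprn_gt0.
pose k (d : R) := Num.trunc (- ln d / la).
have kP d : 0 < d < 1 -> (k d)%:R * la <= - ln d < (k d).+1%:R * la.
  move=> d01; have ld : 0 <= - ln d / la.
    by rewrite divr_ge0 ?(ltW la0) // oppr_ge0 ltW // ln_lt0.
  by have /andP[] := truncn_itv ld; rewrite ler_pdivlMr // ltr_pdivrMr // => -> ->.
have ck : k d @[d --> 0^'+] --> \oo.
  apply/cvgnyPge => A; near=> d.
  have d0 : 0 < d by near: d; exact: nbhs_right_gt.
  have dA : d <= rho ^+ A.
    by near: d; apply: nbhs_right_ltW; rewrite exprn_gt0.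
  have lA : A%:R <= - ln d / la.
    by rewrite ler_pdivlMr // -lnX lerN2 ler_ln ?posrE.
  by rewrite truncn_ge_nat // (le_trans _ lA).
(* The lower bound pairs the value at the coarser scale with the larger denominator, the upper bound
   [ch] does the reverse; the index shift costs a factor tending to 1. *)
have cf : phi (rho ^+ n) / (n.+1%:R * la) @[n --> \oo] --> l / la.
  have : phi (rho ^+ n) / n%:R * (1 - n.+1%:R^-1) / la @[n --> \oo]
      --> l * (1 - 0) / la.
    apply: cvgMr_tmp; apply: cvgM => //; apply: cvgB; first exact: cvg_cst.
    exact: cvg_harmonic.
  rewrite subr0 mulr1; apply: cvg_trans; apply: near_eq_cvg; near=> n.
  have n0 : (0 : R) < n%:R by rewrite ltr0n; near: n; exact: nbhs_infty_gt.
  rewrite -natr1; field; rewrite ?gt_eqF //; lra.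
have ch : phi (rho ^+ n.+1) / (n%:R * la) @[n --> \oo] --> l / la.
  have : phi (rho ^+ n.+1) / n.+1%:R * (1 + n%:R^-1) / la @[n --> \oo]
      --> l * (1 + 0) / la.
    apply: cvgMr_tmp; apply: cvgM; first by rewrite -cvg_shiftS in cphi.
    by apply: cvgD; [exact: cvg_cst|exact: cvg_invn].
  rewrite addr0 mulr1; apply: cvg_trans; apply: near_eq_cvg; near=> n.
  have n0 : (0 : R) < n%:R by rewrite ltr0n; near: n; exact: nbhs_infty_gt.
  rewrite -natr1; field; rewrite ?gt_eqF //; lra.
have {}cf := cvg_comp _ _ ck cf; have {}ch := cvg_comp _ _ ck ch.
apply: squeeze_cvgr cf ch; near=> d => /=.
have d0 : 0 < d by near: d; exact: nbhs_right_gt.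
have d1 : d < 1 by near: d; exact: nbhs_right_lt.
(* With [k d = 0] the upper bound would divide by zero and take the default value 0. *)
have k0 : (0 < k d)%N.
  near: d; have /cvgnyPge/(_ 1%N) := ck; exact.
have d01 : 0 < d < 1 by rewrite d0.
have /andP[kl kr] := kP d d01.
have ld : 0 < - ln d by rewrite oppr_gt0 ln_lt0.
have dl : d <= rho ^+ k d by rewrite -ler_ln ?posrE // -lerN2 lnX.
have dr : rho ^+ (k d).+1 <= d.
  by rewrite -ler_ln ?posrE // -lerN2 lnX ltW.
apply/andP; split.
  apply: ler_pM; rewrite ?invr_ge0 ?phi0 ?(ltW kr) ?phi_le //.
    by rewrite mulr_ge0 ?ler0n // ltW.
  by rewrite lef_pV2 ?posrE ?(ltW kr) // mulr_gt0 // ltr0n.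
apply: ler_pM; rewrite ?invr_ge0 ?phi0 ?(ltW ld) ?phi_le //.
by rewrite lef_pV2 ?posrE // mulr_gt0 // ltr0n.
Unshelve. all: by end_near. Qed.

Lemma exprn_lt (R : realType) (r e : R) :
  0 < r < 1 -> 0 < e -> exists2 n, (0 < n)%N & r ^+ n < e.
Proof.
move=> /andP[r0 r1] e0.
have /cvgrPdist_lt/(_ e e0) : r ^+ n @[n --> \oo] --> 0.
  by apply: cvg_expr; rewrite gtr0_norm.
move=> [n _ nP]; exists n.+1 => //.
by have := nP n.+1 (leqnSn n); rewrite sub0r normrN gtr0_norm ?exprn_gt0.
Qed.

(** * Self-similar subsets of the line *)

Lemma ball_cover_affine (R : realType) (K F : set R) (c t d : R) (s : seq R) :
  0 < c -> (forall u, K u -> F (c * u + t)) -> ball_cover F (c * d) s ->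
  ball_cover K d [seq (z - t) / c | z <- s].
Proof.
move=> c0 KF cs u /KF/cs[z /= zs zu]; exists ((z - t) / c); first exact: map_f.
rewrite /ball/= in zu *.
have -> : (z - t) / c - u = (z - (c * u + t)) / c by field; rewrite gt_eqF.
rewrite normrM normfV (gtr0_norm c0) ltr_pdivrMr //.
by have -> : d / 2 * c = c * d / 2 by ring.
Qed.

(** All levels [m] are recorded at once, and [s] may repeat a translation: distinct maps of the
    plane can share a projection, so [N ^ m] counts words rather than maps of the line. *)
Definition self_similar (R : realType) (K : set R) (r : R) (N : nat) : Prop :=
  forall m, exists s : seq R,
    [/\ size s = (N ^ m)%N,
        forall t u, t \in s -> K u -> K (r ^+ m * u + t) &
        forall x, K x -> exists t u, [/\ t \in s, K u & x = r ^+ m * u + t]].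

Section SelfSimilarSet.
Variables (R : realType) (K : set R) (r : R) (N : nat).
Hypotheses (r01 : 0 < r < 1) (K01 : forall x, K x -> 0 <= x <= 1).
Hypotheses (K_neq0 : K !=set0) (Ksim : self_similar K r N).

Let rX0 n : 0 < r ^+ n. Proof. by rewrite exprn_gt0 //; case/andP: r01. Qed.

Lemma self_similar_cover m d :
  r ^+ m < d / 2 -> exists2 s, ball_cover K d s & size s = (N ^ m)%N.
Proof.
move=> rd; have [s [ss _ Ks]] := Ksim m; exists s => // x /Ks[t [u [ts Ku ->]]].
exists t => //=; rewrite /ball/= opprD addrCA subrr addr0 normrN.
have /andP[u0 u1] := K01 Ku.
rewrite ger0_norm ?mulr_ge0 ?(ltW (rX0 m)) //; apply: le_lt_trans rd.
by rewrite ler_piMr // ltW.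
Qed.

Lemma self_similar_cover_ex d : 0 < d -> exists s, ball_cover K d s.
Proof.
move=> d0; have d20 : 0 < d / 2 by rewrite divr_gt0.
by have [m _ /self_similar_cover[s cs _]] := exprn_lt r01 d20; exists s.
Qed.

Lemma self_similar_covering_ge1 d : 0 < d -> 1 <= covering_number K d.
Proof. by move=> /self_similar_cover_ex[s]; exact: covering_number_ge1. Qed.

(* A maximal [3 r^m]-separated set in [K] singles out pieces of [K] of level [m]
   so far apart that a ball of diameter at most [r^m] meets only one of them. *)
Lemma covering_number_supermul m n :
  covering_number K (6 * r ^+ m) * covering_number K (r ^+ n)
  <= covering_number K (r ^+ (m + n)).
Proof.
(* If one ball meets two pieces, their marked points are less than [3 * r ^+ m] apart: [r ^+ m] for
   each piece and for the ball. The doubling in [separated_net] produces the 6. *)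
have e0 : 0 < 3 * r ^+ m by rewrite mulr_gt0.
have [s cs] := self_similar_cover_ex e0.
have [t [ut tK tsep ct]] := separated_net e0 cs.
have e6 : 2 * (3 * r ^+ m) = 6 * r ^+ m by ring.
rewrite e6 in ct.
have [w cw] := self_similar_cover_ex (rX0 n).
apply: (@le_trans _ _ ((size t)%:R * covering_number K (r ^+ n))).
  rewrite ler_wpM2r ?covering_number_le //.
  by apply: le_trans (self_similar_covering_ge1 (rX0 n)).
have [s0 [_ s1 s2]] := Ksim m.
(* [tau x] is the translation of one chosen piece of level [m] through [x]. *)
have /choice[tau tauP] : forall x, exists t', K x ->
    (forall u, K u -> K (r ^+ m * u + t')) /\
    (exists2 u, K u & x = r ^+ m * u + t').
  move=> x.
  have [/s2[t' [u [ts Ku xE]]]|] := pselect (K x); last by exists 0.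
  by exists t' => _; split; [move=> v; exact: s1|exists u].
pose E x := [set r ^+ m * u + tau x | u in K].
have [v cv] := self_similar_cover_ex (rX0 (m + n)).
have EK x : x \in t -> E x `<=` K.
  by move=> xt _ [u Ku <-]; have [h _] := tauP x (tK x xt); exact: h.
rewrite -[leRHS]mul1r.
apply: le_trans (sum_covering_number_le (k := 1) cv EK _).
  have -> : (size t)%:R * covering_number K (r ^+ n) =
      \sum_(x <- t) covering_number K (r ^+ n).
    by rewrite big_const_seq count_predT iter_addr_0 mulr_natl.
  rewrite big_seq [leRHS]big_seq; apply: ler_sum => x xt.
  have cE : ball_cover (E x) (r ^+ (m + n)) v by move=> z /(EK x xt)/cv.
  apply: (covering_number_sub (h := fun z => (z - tau x) / r ^+ m) cE) => z.
  rewrite exprD; apply: ball_cover_affine => // u Ku.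
  by exists u.
(* The only test point is the centre [z]; the set attached to [x] consists of the centres whose ball
   meets [E x], and separation makes these sets disjoint. *)
move=> z; apply: (@count_le_size _ _ t [:: z] _
  (fun x y => ball y (r ^+ (m + n) / 2) `&` E x !=set0)) => //; last first.
  by move=> x _ /asboolP h; exists z => //; rewrite mem_head.
have rr : r ^+ (m + n) <= r ^+ m.
  rewrite exprD ler_piMr ?(ltW (rX0 m)) // exprn_ile1 //.
  - by case/andP: r01 => /ltW.
  - by case/andP: r01 => _ /ltW.
move=> x x' y xt x't [a [/= yx [u Ku aE]]] [a' [/= yx' [u' Ku' aE']]].
rewrite -{}aE in yx; rewrite -{}aE' in yx'.
apply: tsep => //; have [_ [w1 Kw1 ->]] := tauP x (tK x xt).
have [_ [w2 Kw2 ->]] := tauP x' (tK x' x't).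
rewrite /ball/= in yx yx' *.
have bd y' : K y' -> 0 <= r ^+ m * y' <= r ^+ m.
  move=> /K01/andP[y0 y1]; have r0 := ltW (rX0 m).
  by rewrite mulr_ge0 //= ler_piMr.
have /andP[? ?] := bd _ Ku; have /andP[? ?] := bd _ Ku'.
have /andP[? ?] := bd _ Kw1; have /andP[? ?] := bd _ Kw2.
move: yx yx'; rewrite !ltr_norml => /andP[? ?] /andP[? ?].
by apply/andP; split; lra.
Qed.

Lemma self_similar_cvg :
  exists l : R, ln (covering_number K (r ^+ n)) / n%:R @[n --> \oo] --> l.
Proof.
have r1 : r < 1 by case/andP: r01.
(* Going [s] levels deeper absorbs the factor 6, so the logarithms are superadditive up to the index
   defect [s]. *)
have [s s0 rs] : exists2 n, (0 < n)%N & r ^+ n < 6^-1.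
  by apply: exprn_lt; rewrite ?invr_gt0.
have cov1 n := self_similar_covering_ge1 (rX0 n).
have cov_pos n : 0 < covering_number K (r ^+ n) by exact: lt_le_trans (cov1 n).
have K6 n : r ^+ (n + s) * 6 <= r ^+ n.
  rewrite exprD -mulrA ler_piMr ?(ltW (rX0 n)) //; lra.
(* The growth constant comes from the [N ^ (n + s)] pieces of level [n + s] and from
   [n + s <= (s + 1)(n + 1)]. *)
apply: (@cvg_superadditive _ _ s (ln N%:R * s.+1%:R)) => //.
- by move=> n; rewrite ln_ge0.
- move=> m n; rewrite -lnM ?posrE // ler_ln ?posrE ?mulr_gt0 //.
  rewrite addnAC; apply: le_trans (covering_number_supermul _ _).
  rewrite ler_wpM2r ?(ltW (cov_pos n)) //.
  have [t ct] : exists t, ball_cover K (6 * r ^+ (m + s)) t.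
    by apply: self_similar_cover_ex; rewrite mulr_gt0.
  by apply: (covering_number_scale _ ct); rewrite mulrC.
move=> n.
have [|t ct st] := @self_similar_cover (n + s) (r ^+ n).
  have := K6 n; have := rX0 (n + s); lra.
have N0 : (0 < N)%N.
  have : (0 < N ^ (n + s))%N.
    by rewrite -st -(ltr_nat R); apply: lt_le_trans (covering_number_le ct).
  by rewrite expn_gt0 addn_eq0 (gtn_eqF s0) andbF orbF.
apply: (@le_trans _ _ (ln ((N ^ (n + s))%:R))).
  rewrite ler_ln ?posrE // -?st ?covering_number_le //.
  exact: lt_le_trans (covering_number_le ct).
rewrite natrX lnXn ?ltr0n // -mulrA -natrM -[ln _ *+ _]mulr_natr ler_wpM2l //.
  by rewrite ln_ge0 // (ler_nat _ 1).
by rewrite ler_nat mulSn mulnS addSn leqW // leq_add2l leq_addr.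
Qed.

Lemma self_similar_box_dim :
  box_dim_exists K.
Proof.
have [l cl] := self_similar_cvg.
apply: cvgP; apply: (cvg_geometric_scale r01 _ _ cl) => [d d0|d e d0 de].
  by rewrite ln_ge0 // self_similar_covering_ge1.
have e0 := lt_le_trans d0 de.
have ge1 := self_similar_covering_ge1.
rewrite ler_ln ?posrE ?(lt_le_trans _ (ge1 _ _)) //.
by have [s cs] := self_similar_cover_ex d0; exact: covering_number_scale cs.
Qed.

End SelfSimilarSet.

(** * Convex hulls and diagonal affine maps *)

Lemma convex_affine_preimage (R : realType) (c t : R) :
  @convex_set R R^o [set x : R | 0 <= c * x + t <= 1].
Proof.
move=> x y a; rewrite !inE /= => /andP[x0 x1] /andP[y0 y1].
have a0 : 0 <= a%:num by [].
have a1 : a%:num <= 1 by [].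
suff : 0 <= c * (a%:num * (x : R) + (1 - a%:num) * (y : R)) + t <= 1 by [].
move: (a%:num) a0 a1 => b b0 b1.
have -> : c * (b * x + (1 - b) * y) + t = b * (c * x + t) + (1 - b) * (c * y + t).
  by ring.
by apply/andP; split; nra.
Qed.

(** The preimage of [[0, 1]] under the map is convex and contains [A], hence contains the hull; the
    bounds are read off at the end points 0 and 1. *)
Lemma convex_hull_affine (R : realType) (A : set R) (c t : R) :
  convex_hull A = `[0, 1]%classic -> (forall x, A x -> A (c * x + t)) ->
  0 <= t <= 1 /\ 0 <= c + t <= 1.
Proof.
move=> hullA Ac.
have A01 x : A x -> 0 <= x <= 1.
  move=> Ax; have : convex_hull A x by exact: sub_gen_smallest.
  by rewrite hullA /= in_itv.
have sub : convex_hull A `<=` [set x | 0 <= c * x + t <= 1].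
  by apply: smallest_sub; [exact: convex_affine_preimage|move=> x /Ac/A01].
rewrite hullA in sub; split.
  by have := sub 0; rewrite /= in_itv /= lexx ler01 mulr0 add0r; exact.
by have := sub 1; rewrite /= in_itv /= lexx ler01 mulr1; exact.
Qed.

Lemma setX_itv01_inj (R : realType) (A B : set R) :
  A `*` B = `[0, 1] `*` `[0, 1] -> A = `[0, 1]%classic /\ B = `[0, 1]%classic.
Proof.
move=> AB.
have i0 : `[0, 1]%classic (0 : R) by rewrite /= in_itv /= lexx ler01.
have [A0 B0] : (A `*` B) (0, 0) by rewrite AB.
split; apply/seteqP; split=> x hx.
- by have : (A `*` B) (x, 0) by []; rewrite AB => -[].
- by have [] : (A `*` B) (x, 0) by rewrite AB.
- by have : (A `*` B) (0, x) by []; rewrite AB => -[].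
- by have [] : (A `*` B) (0, x) by rewrite AB.
Qed.

Lemma diag_affine_comp (R : realType) (r r' t t' : R * R) :
  diag_affine r t \o diag_affine r' t'
  = diag_affine (r.1 * r'.1, r.2 * r'.2) (r.1 * t'.1 + t.1, r.2 * t'.2 + t.2).
Proof.
by apply/funext => p; rewrite /diag_affine /=; congr (_, _); ring.
Qed.

Lemma diag_affine_inj (R : realType) (r t : R * R) :
  r.1 != 0 -> r.2 != 0 -> injective (diag_affine r t).
Proof.
move=> r1 r2 [x y] [x' y'] [/addIr/(mulfI r1)/= -> /addIr/(mulfI r2)/= ->].
by [].
Qed.

Lemma card_fset_set_uniq (T : choiceType) (A : set T) (s : seq T) :
  uniq s -> (forall x, x \in s <-> A x) -> #|` fset_set A| = size s.
Proof.
move=> us sA.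
have fA : finite_set A.
  by apply/finite_seqP; exists s; apply/seteqP; split=> x /sA.
apply: perm_size; rewrite uniq_perm ?fset_uniq // => x.
rewrite in_fset_set //; apply/idP/idP => [/set_mem/sA //|/sA].
exact: mem_set.
Qed.

(** * Words of carpet maps and their rectangles *)

Section Carpet.
Variables (R : realType) (G : set (R * R -> R * R)) (L : set (R * R)).
Variables (r1 r2 : R).
Hypotheses (r1_01 : 0 < r1 < 1) (r2_01 : 0 < r2 < 1) (r1_le_r2 : r1 <= r2).
Hypothesis finG : finite_set G.
Hypothesis homG : forall S, G S -> exists t : R * R,
  [/\ S = diag_affine (r1, r2) t, 0 <= t.1 <= 1 - r1 & 0 <= t.2 <= 1 - r2].
Hypothesis L01 : forall p, L p -> 0 <= p.1 <= 1 /\ 0 <= p.2 <= 1.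
Hypothesis L_neq0 : L !=set0.
Hypothesis L_eq : L = \bigcup_(f in G) (f @` L).
Hypothesis oscG : rectangular_osc G.

Let Q : set (R * R) := `]0, 1[ `*` `]0, 1[.
Let N := #|` fset_set G|.
Let K := snd @` L.

Let r1_gt0 : 0 < r1. Proof. by case/andP: r1_01. Qed.
Let r2_gt0 : 0 < r2. Proof. by case/andP: r2_01. Qed.
Let r1X n : 0 < r1 ^+ n. Proof. exact: exprn_gt0. Qed.
Let r2X n : 0 < r2 ^+ n. Proof. exact: exprn_gt0. Qed.

Let inQ p : Q p <-> 0 < p.1 < 1 /\ 0 < p.2 < 1.
Proof. by rewrite /Q /=!in_itv. Qed.

Lemma compositions_diag_affine n f : compositions G n f ->
  exists t, f = diag_affine (r1 ^+ n, r2 ^+ n) t.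
Proof.
elim: n f => [f ->|n IH _ [f /homG[t [-> _ _]]] [g /IH[t' ->] <-]].
  by exists (0, 0); apply/funext => -[x y]; rewrite /diag_affine /= !mul1r !addr0.
by rewrite diag_affine_comp /= -!exprS; eexists.
Qed.

Lemma compositions_subset n f p : compositions G n f -> L p -> L (f p).
Proof.
elim: n f p => [f p -> //|n IH _ p [f Gf] [g /IH gL <-] Lp].
by rewrite L_eq; exists f => //; exists (g p) => //; exact: gL.
Qed.

Lemma compositions_cover n p :
  L p -> exists2 f, compositions G n f & (f @` L) p.
Proof.
elim: n p => [|n IH] p Lp; first by exists id => //; exists p.
move: Lp; rewrite {1}L_eq => -[f Gf [q /IH[g gn [q' Lq' <-]] <-]].
by exists (f \o g); [exists f => //; exists g|exists q'].
Qed.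

Lemma compositions_open_square n f p : compositions G n f -> Q p -> Q (f p).
Proof.
elim: n f p => [f p -> //|n IH _ p [f /homG[t [-> t1 t2]]] [g /IH gQ <-] /gQ].
rewrite !inQ /= => -[/andP[x0 x1] /andP[y0 y1]].
move: (g p) x0 x1 y0 y1 => [x y] /= x0 x1 y0 y1.
have /andP[? ?] := t1; have /andP[? ?] := t2.
have := r1_gt0; have := r2_gt0 => ? ?.
by split; apply/andP; split; nra.
Qed.

Let G_inj f : G f -> injective f.
Proof.
by move=> /homG[t [-> _ _]]; apply: diag_affine_inj; rewrite gt_eqF.
Qed.

(** Induction on the word: different first letters contradict the rectangular open set condition,
    since the tails keep points in [Q], and an equal first letter cancels by injectivity. This
    serves both to count words and to separate rectangles. *)
Lemma compositions_disjoint n f g p q :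
  compositions G n f -> compositions G n g -> Q p -> Q q -> f p = g q -> f = g.
Proof.
elim: n f g p q => [f g p q -> -> //|n IH].
move=> _ _ p q [a Ga] [f fn <-] [b Gb] [g gn <-] Qp Qq /= fg.
have ab : a = b.
  apply: contrapT => /(oscG Ga Gb) abQ.
  have : set0 (a (f p)); last by [].
  rewrite -abQ; split; first by exists (f p) => //; exact: compositions_open_square fn Qp.
  by rewrite fg; exists (g q) => //; exact: compositions_open_square gn Qq.
by rewrite -ab in fg *; rewrite (IH f g p q) //; exact: G_inj fg.
Qed.

Lemma compositions_enum n : exists s : seq (R * R -> R * R),
  [/\ uniq s, size s = (N ^ n)%N & forall f, f \in s <-> compositions G n f].
Proof.
elim: n => [|n [s [us ss sE]]].
  exists [:: id]; split => // f; rewrite inE.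
  by split => [/eqP|->].
exists [seq f \o g | f <- enum_fset (fset_set G), g <- s].
have inG f : f \in enum_fset (fset_set G) <-> G f.
  rewrite -[f \in enum_fset _]/(f \in fset_set G) in_fset_set //.
  by split => [/set_mem|/mem_set].
split.
- apply: allpairs_uniq => //; first exact: fset_uniq.
  move=> u v /allpairsP[[a f] /= [/inG Ga /sE fn ->]].
  move=> /allpairsP[[b g] /= [/inG Gb /sE gn ->]] /= fg.
  (* Evaluating two equal words at the centre of the square lets disjointness identify first the
     outer letters, as words of length 1, then the tails. *)
  pose p : R * R := (2^-1, 2^-1).
  have Qp : Q p by rewrite inQ /=; split; lra.
  have fgp : a (f p) = b (g p) by have := congr1 (fun h => h p) fg.
  have ab : a = b.
    apply: (@compositions_disjoint 1%N a b (f p) (g p)) => //.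
    + by exists a => //; exists id => //.
    + by exists b => //; exists id => //.
    + exact: compositions_open_square fn Qp.
    + exact: compositions_open_square gn Qp.
  rewrite -ab in fgp *; congr (_, _).
  by apply: (@compositions_disjoint n f g p p) => //; exact: G_inj fgp.
- by rewrite size_allpairs ss expnS.
move=> h; split => [/allpairsP[[a f] /= [/inG Ga /sE fn ->]]|[a Ga [f fn <-]]].
  by exists a => //; exists f.
by apply/allpairsP; exists (a, f); split; [exact/inG|exact/sE|].
Qed.

Lemma proj2_self_similar : self_similar K r2 N.
Proof.
move=> m; have [s [us ss sE]] := compositions_enum m.
exists [seq (f (0, 0)).2 | f <- s]; split; first by rewrite size_map.
  move=> _ _ /mapP[f /sE fm ->] [p Lp <-]; have [t fE] := compositions_diag_affine fm.
  exists (f p); first exact: compositions_subset fm Lp.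
  by rewrite fE /diag_affine /= mulr0 add0r.
move=> _ [p Lp <-]; have [f fm [q Lq <-]] := compositions_cover m Lp.
have [t fE] := compositions_diag_affine fm.
exists (f (0, 0)).2, q.2; split; [|by exists q|].
  by apply/mapP; exists f => //; exact/sE.
by rewrite fE /diag_affine /= mulr0 add0r.
Qed.

Let N_gt0 : (0 < N)%N.
Proof.
rewrite lt0n cardfs_eq0; apply/eqP => G0.
have [p] := L_neq0; rewrite L_eq => -[f Gf _].
by have := mem_set Gf; rewrite -in_fset_set // G0.
Qed.

Lemma growth_ratio_cvg : growth_ratio G r1 n @[n --> \oo] --> ln N%:R / - ln r1.
Proof.
have lr1 : ln r1 < 0 by exact: ln_lt0.
(* The sequence is constant for positive [n]; at [n = 0] its denominator vanishes. *)
apply: cvg_near_cst; near=> n; rewrite /growth_ratio.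
have [s [us ss sE]] := compositions_enum n.
have n0 : (0 : R) < n%:R by rewrite ltr0n; near: n; exact: nbhs_infty_gt.
rewrite (card_fset_set_uniq us sE) ss natrX lnXn ?ltr0n // -mulr_natl.
by field; rewrite (lt_eqF lr1) (gt_eqF n0).
Unshelve. all: by end_near. Qed.

(** * Covering the carpet at scale [r1 ^ n] *)

Let K_neq0 : K !=set0. Proof. by have [p Lp] := L_neq0; exists p.2, p. Qed.

Let K01 x : K x -> 0 <= x <= 1. Proof. by move=> [p /L01[_ +] <-]. Qed.

Let K_cover d := self_similar_cover_ex r2_01 K01 proj2_self_similar (d := d).
Let K_ge1 d :=
  self_similar_covering_ge1 r2_01 K01 K_neq0 proj2_self_similar (d := d).

Let ratio_gt0 n : 0 < (r1 / r2) ^+ n.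
Proof. by rewrite exprn_gt0 // divr_gt0. Qed.

Let ratioE n : r2 ^+ n * (r1 / r2) ^+ n = r1 ^+ n.
Proof. by rewrite -exprMn mulrC divfK // gt_eqF. Qed.

(* The piece [f @` L] has width [r1 ^+ n]: two columns of squares of that side
   cover it. *)
Lemma piece_cover n f : compositions G n f ->
  exists2 t, ball_cover (f @` L) (r1 ^+ n) t &
    (size t)%:R <= 2 * covering_number K ((r1 / r2) ^+ n).
Proof.
move=> fn; have [t fE] := compositions_diag_affine fn.
have [s0 /covering_number_attained[s cs ->]] := K_cover (ratio_gt0 n).
(* Centres at one and three quarters of the width leave a margin of [r1 ^+ n / 4]; a single column
   of open balls of radius [r1 ^+ n / 2] could miss the vertical edges. *)
exists ([seq (t.1 + r1 ^+ n / 4, r2 ^+ n * y + t.2) | y <- s] ++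
        [seq (t.1 + r1 ^+ n * 3 / 4, r2 ^+ n * y + t.2) | y <- s]); last first.
  by rewrite size_cat !size_map natrD; lra.
have D0 := r1X n.
move=> _ [p Lp <-]; have [/andP[x0 x1] _] := L01 Lp.
have [y /= ys] := cs p.2 (ex_intro2 _ _ p Lp erefl).
rewrite /ball/= => yp.
have b2 : ball (r2 ^+ n * y + t.2) (r1 ^+ n / 2) (r2 ^+ n * p.2 + t.2).
  rewrite /ball/=.
  have -> : r2 ^+ n * y + t.2 - (r2 ^+ n * p.2 + t.2) = r2 ^+ n * (y - p.2).
    by ring.
  by rewrite normrM gtr0_norm // -ratioE -mulrA ltr_pM2l.
have [xl|xl] := leP p.1 2^-1.
  exists (t.1 + r1 ^+ n / 4, r2 ^+ n * y + t.2).
    by rewrite /= mem_cat map_f.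
  rewrite fE; split => //=; rewrite /ball/= ltr_norml; apply/andP; split; nra.
exists (t.1 + r1 ^+ n * 3 / 4, r2 ^+ n * y + t.2).
  by rewrite /= mem_cat map_f // orbT.
rewrite fE; split => //=; rewrite /ball/= ltr_norml; apply/andP; split; nra.
Qed.

Lemma carpet_cover n : (exists t, ball_cover L (r1 ^+ n) t) /\
  covering_number L (r1 ^+ n)
  <= (N ^ n)%:R * (2 * covering_number K ((r1 / r2) ^+ n)).
Proof.
have [s [us ss sE]] := compositions_enum n.
rewrite -ss.
apply: (@covering_number_bigU _ _ _ s (fun f => f @` L)).
  move=> p /(compositions_cover n)[f fn fp]; exists f => //=; exact/sE.
by move=> f /sE; exact: piece_cover.
Qed.

Lemma carpet_cover_ex d : 0 < d -> exists t, ball_cover L d t.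
Proof.
move=> d0; have [n _ nd] := exprn_lt r1_01 d0.
have [[t ct] _] := carpet_cover n; exists t => p /ct[q qt qp]; exists q => //.
by apply: le_ball qp; rewrite ler_pM2r ?invr_gt0 // ltW.
Qed.

Lemma carpet_covering_ge1 d : 0 < d -> 1 <= covering_number L d.
Proof. by move=> /carpet_cover_ex[s]; exact: covering_number_ge1. Qed.

(* A window of length [d] around [p] touching a closed interval of length
   [h >= d] has its centre or an end point inside the open interval. *)
Let window_point (p t z h d : R) : 0 < d -> d <= h -> t <= z <= t + h ->
  `|p - z| < d / 2 ->
  exists2 e, e \in [:: p - d / 2; p; p + d / 2] & t < e < t + h.
Proof.
move=> d0 dh /andP[tz zh]; rewrite ltr_norml => /andP[pl pr].
have [tl|tl] := ltP t (p - d / 2).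
  by exists (p - d / 2); rewrite ?inE ?eqxx //; apply/andP; split; lra.
have [hl|hl] := ltP (p + d / 2) (t + h).
  by exists (p + d / 2); rewrite ?inE ?eqxx ?orbT //; apply/andP; split; lra.
by exists p; rewrite ?inE ?eqxx ?orbT //; apply/andP; split; lra.
Qed.

Lemma carpet_covering_lower n :
  (N ^ n)%:R * covering_number K ((r1 / r2) ^+ n)
  <= 9 * covering_number L (r1 ^+ n).
Proof.
have [s [us ss sE]] := compositions_enum n.
have [[v cv] _] := carpet_cover n.
have subL f : f \in s -> f @` L `<=` L.
  by move=> /sE fn _ [p Lp <-]; exact: compositions_subset fn Lp.
have r12n : r1 ^+ n <= r2 ^+ n by apply: lerXn2r; rewrite ?nnegrE // ltW.
rewrite -ss.
apply: le_trans (sum_covering_number_le (k := 9) cv subL _).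
  have -> : (size s)%:R * covering_number K ((r1 / r2) ^+ n) =
      \sum_(f <- s) covering_number K ((r1 / r2) ^+ n).
    by rewrite big_const_seq count_predT iter_addr_0 mulr_natl.
  rewrite big_seq [leRHS]big_seq; apply: ler_sum => f fs.
  have cf : ball_cover (f @` L) (r1 ^+ n) v by move=> p /(subL f fs)/cv.
  have /sE/compositions_diag_affine[t fE] := fs.
  (* Centres projected to the second axis and divided by [r2 ^+ n] turn a cover of the piece at
     scale [r1 ^+ n] into one of [K] at scale [(r1 / r2) ^+ n]. *)
  apply: (covering_number_sub (h := fun z => (z.2 - t.2) / r2 ^+ n) cf) => w cw.
  rewrite (map_comp (fun z => (z - t.2) / r2 ^+ n) snd).
  apply: (@ball_cover_affine _ _ (snd @` (f @` L))) => //.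
    by move=> _ [p Lp <-]; exists (f p); [exists p|rewrite fE].
  rewrite ratioE => _ [q /cw[z zw [_ zq]] <-]; exists z.2 => //=.
  exact: map_f.
move=> z.
pose D := r1 ^+ n.
(* Nine test points: the corners, edge midpoints and centre of the square of side [D] around [z].
   Any rectangle whose piece of [L] meets the square has one of them in its interior, and the
   interiors are disjoint even where pieces touch. *)
pose P := [seq (x, y) | x <- [:: z.1 - D / 2; z.1; z.1 + D / 2],
                        y <- [:: z.2 - D / 2; z.2; z.2 + D / 2]].
apply: (@count_le_size _ _ s P _ (fun f => f @` Q)) => //.
  move=> f g x /sE fn /sE gn [p Qp px] [q Qq qx].
  by apply: (compositions_disjoint fn gn Qp Qq); rewrite px qx.
move=> f fs /asboolP[w [[z1 z2] [p Lp pE]]].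
have /sE/compositions_diag_affine[t fE] := fs.
have [/andP[x0 x1] /andP[y0 y1]] := L01 Lp.
rewrite -pE fE /ball/= in z1 z2.
have [D0 D2] := (r1X n, r2X n).
(* Horizontally the rectangle is exactly as wide as the square; vertically [r1 <= r2] makes it at
   least as high. *)
have [|e1 e1P e1t] := @window_point z.1 t.1 _ D D D0 (lexx _) _ z1.
  by apply/andP; split; rewrite /D; nra.
have [|e2 e2P e2t] := @window_point z.2 t.2 _ (r2 ^+ n) D D0 r12n _ z2.
  by apply/andP; split; nra.
exists (e1, e2); first by apply/allpairsP; exists (e1, e2).
exists ((e1 - t.1) / r1 ^+ n, (e2 - t.2) / r2 ^+ n).
  move: e1t e2t; rewrite /D => /andP[? ?] /andP[? ?].
  rewrite inQ /=; split; rewrite divr_gt0 ?subr_gt0 //= ltr_pdivrMr //; lra.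
by rewrite fE /diag_affine /= mulrC divfK ?gt_eqF // subrK mulrC divfK ?gt_eqF // subrK.
Qed.

(** * Passage to the limit *)

Let cvg_proj2 (a : R) : box_ratio K d @[d --> 0^'+] --> a ->
  ln (covering_number K ((r1 / r2) ^+ n)) / n%:R @[n --> \oo]
    --> a * (ln r2 - ln r1).
Proof.
(* When [r1 = r2] the scale stays at 1 instead of tending to 0, but the limit and the claimed value
   are then both 0. *)
move=> ca; have [r12|r12] := eqVneq r1 r2.
  rewrite -r12 subrr mulr0 divff ?gt_eqF //.
  have c1 : ln (covering_number K 1) * n%:R^-1 @[n --> \oo] --> (0 : R).
    rewrite -(mulr0 (ln (covering_number K 1))).
    by apply: cvgM; [exact: cvg_cst | exact: cvg_invn].
  by apply: cvg_trans c1; apply: near_eq_cvg; near=> n; rewrite expr1n.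
have q0 : 0 < r1 / r2 by rewrite divr_gt0.
have q1 : r1 / r2 < 1 by rewrite ltr_pdivrMr // mul1r lt_neqAle r12.
have lq : ln (r1 / r2) < 0 by rewrite ln_lt0 // q0.
have cq : box_ratio K ((r1 / r2) ^+ n) @[n --> \oo] --> a.
  move/cvg_at_rightP : ca; apply; split => //.
  by apply: cvg_expr; rewrite gtr0_norm.
have -> : ln r2 - ln r1 = - ln (r1 / r2) by rewrite ln_div ?posrE // opprB.
have {}cq : box_ratio K ((r1 / r2) ^+ n) * - ln (r1 / r2) @[n --> \oo]
    --> a * - ln (r1 / r2) by exact: cvgMr_tmp.
apply: cvg_trans cq; apply: near_eq_cvg; near=> n.
have n0 : (0 : R) < n%:R by rewrite ltr0n; near: n; exact: nbhs_infty_gt.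
rewrite /box_ratio lnXn // -[ln _ *+ _]mulr_natl.
by field; rewrite (lt_eqF lq) (gt_eqF n0).
Unshelve. all: by end_near. Qed.

(** The two counting bounds put the logarithm of the covering number at scale [r1 ^+ n] within a
    constant of [n * ln N + A n]; division by [n] removes the constant, and [cvg_geometric_scale]
    passes to all scales. *)
Lemma carpet_box_ratio (a : R) : box_ratio K d @[d --> 0^'+] --> a ->
  box_ratio L d @[d --> 0^'+] -->
    ln N%:R / - ln r1 + a * (1 - ln r2 / ln r1).
Proof.
move=> /cvg_proj2 cA; have lr1 : ln r1 < 0 by exact: ln_lt0.
have -> : ln N%:R / - ln r1 + a * (1 - ln r2 / ln r1) =
    (ln N%:R + a * (ln r2 - ln r1)) / - ln r1.
  by field; rewrite lt_eqF.
pose A n := ln (covering_number K ((r1 / r2) ^+ n)).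
have cB (c : R) : (ln N%:R + A n / n%:R) + c / n%:R @[n --> \oo]
    --> ln N%:R + a * (ln r2 - ln r1).
  rewrite -[X in _ --> X]addr0; apply: cvgD.
    by apply: cvgD => //; exact: cvg_cst.
  by rewrite -(mulr0 c); apply: cvgM; [exact: cvg_cst | exact: cvg_invn].
have Npos : (0 : R) < N%:R by rewrite ltr0n.
have Lpos d : 0 < d -> 0 < covering_number L d.
  by move=> d0; exact: lt_le_trans (carpet_covering_ge1 d0).
apply: (@cvg_geometric_scale _ (fun d => ln (covering_number L d)) r1 _ r1_01)
  => [d d0|d e d0 de|].
- by rewrite ln_ge0 // carpet_covering_ge1.
- have e0 := lt_le_trans d0 de; rewrite ler_ln ?posrE ?Lpos //.
  by have [s cs] := carpet_cover_ex d0; exact: covering_number_scale cs.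
apply: squeeze_cvgr (cB (- ln 9)) (cB (ln 2)); near=> n.
have n0 : (0 : R) < n%:R by rewrite ltr0n; near: n; exact: nbhs_infty_gt.
have C0 : 0 < covering_number K ((r1 / r2) ^+ n).
  exact: lt_le_trans (K_ge1 (ratio_gt0 n)).
have lnN : ln (N ^ n)%:R = n%:R * ln N%:R :> R.
  by rewrite natrX lnXn // mulr_natl.
have Nn0 : (0 : R) < (N ^ n)%:R by rewrite ltr0n expn_gt0 N_gt0.
have E c : ln N%:R + A n / n%:R + c / n%:R = (n%:R * ln N%:R + A n + c) / n%:R.
  by field; rewrite gt_eqF.
have Ln := Lpos _ (r1X n).
rewrite !E !ler_pM2r ?invr_gt0 // -lnN; apply/andP; split.
  rewrite lerBlDl -!lnM ?posrE ?mulr_gt0 // ler_ln ?posrE ?mulr_gt0 //.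
  exact: carpet_covering_lower.
rewrite -!lnM ?posrE ?mulr_gt0 // ler_ln ?posrE ?mulr_gt0 //.
have [_ h] := carpet_cover n; apply: le_trans h _.
by rewrite [2 * _]mulrC mulrA.
Unshelve. all: by end_near. Qed.

End Carpet.

Theorem corollary1p4 (R : realType) (G : set (R * R -> R * R))
    (L : set (R * R)) (r1 r2 : R)
    (carpetG : self_affine_carpet G)
    (attractorL : is_attractor G L)
    (unit_square : convex_hull (fst @` L) `*` convex_hull (snd @` L)
                   = `[0, 1] `*` `[0, 1])
    (homG : homogeneous G r1 r2) (r1_le_r2 : r1 <= r2)
    (oscG : rectangular_osc G)
    (wscG : weak_separation (proj2_ifs G)) :
  [/\ box_dim_exists L,
      box_dim_exists (snd @` L),
      cvg (growth_ratio G r1 n @[n --> \oo]) &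
      box_dim L = lim (growth_ratio G r1 n @[n --> \oo])
                  + box_dim (snd @` L) * (1 - ln r2 / ln r1)].
Proof.
have [finG affG] := carpetG; have [L0 _ L_eq] := attractorL.
have [r1_gt0 r2_gt0 transG] := homG.
have [hull1 hull2] := setX_itv01_inj unit_square.
have L01 p : L p -> 0 <= p.1 <= 1 /\ 0 <= p.2 <= 1.
  move=> Lp; split.
    have : convex_hull (fst @` L) p.1 by apply: sub_gen_smallest; exists p.
    by rewrite hull1 /= in_itv.
  have : convex_hull (snd @` L) p.2 by apply: sub_gen_smallest; exists p.
  by rewrite hull2 /= in_itv.
have [S GS] : exists S, G S.
  by have [p] := L0; rewrite L_eq => -[S GS _]; exists S.
(* Homogeneity gives positivity only; comparing the two forms of a map at [(0, 0)] and [(1, 1)]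
   identifies the ratios, and the carpet condition bounds them by 1. *)
have [r1_lt1 r2_lt1] : r1 < 1 /\ r2 < 1.
  have [r [t [/andP[_ a1] /andP[_ a2] SE]]] := affG S GS.
  have [t' SE'] := transG S GS.
  have E p : diag_affine r t p = diag_affine (r1, r2) t' p by rewrite -SE SE'.
  have := (E (0, 0), E (1, 1)); rewrite /diag_affine /= => -[].
  rewrite !mulr0 !mulr1 !add0r => -[-> ->] [/addIr rr1 /addIr rr2].
  by rewrite -rr1 -rr2; split;
    [exact: le_lt_trans (ler_norm _) a1|exact: le_lt_trans (ler_norm _) a2].
have r1_01 : 0 < r1 < 1 by rewrite r1_gt0.
have r2_01 : 0 < r2 < 1 by rewrite r2_gt0.
(* The hull condition turns invariance of [L] into invariance of the unit square, which the bounds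
   on [t] express. *)
have homG' f : G f -> exists t : R * R,
    [/\ f = diag_affine (r1, r2) t, 0 <= t.1 <= 1 - r1 & 0 <= t.2 <= 1 - r2].
  move=> Gf; have [t fE] := transG f Gf; exists t.
  have Lf p : L p -> L (f p) by move=> Lp; rewrite L_eq; exists f => //; exists p.
  have [|/andP[t1 _] /andP[_ t1']] := @convex_hull_affine _ _ r1 t.1 hull1.
    by move=> _ [p /Lf Lfp <-]; exists (f p) => //; rewrite fE.
  have [|/andP[t2 _] /andP[_ t2']] := @convex_hull_affine _ _ r2 t.2 hull2.
    by move=> _ [p /Lf Lfp <-]; exists (f p) => //; rewrite fE.
  by split => //; [rewrite t1|rewrite t2] => /=; lra.
have K01 x : (snd @` L) x -> 0 <= x <= 1 by move=> [p /L01[_ +] <-].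
have K0 : snd @` L !=set0 by have [p Lp] := L0; exists p.2, p.
have cK : box_dim_exists (snd @` L).
  by apply: (self_similar_box_dim r2_01 K01 K0);
    exact: (proj2_self_similar r1_01 r2_01 finG homG' L_eq oscG).
have cG := growth_ratio_cvg r1_01 r2_01 finG homG' L0 L_eq oscG.
(* [cK] unfolds to convergence towards the [lim] defining [box_dim], so the value [a] here is the
   box dimension of the projection. *)
have cL := carpet_box_ratio r1_01 r2_01 r1_le_r2 finG homG' L01 L0 L_eq oscG cK.
split; [exact: cvgP cL | exact: cK | exact: cvgP cG |].
by rewrite /box_dim (cvg_lim _ cL) // (cvg_lim _ cG).
Qed.
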